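(* Let $f(z)=\sum_{k=0}^{\infty} c_k z^k$ be an entire function on $\mathbb{C}$, and let $M_f(r)=\max_{|z|\le r}|f(z)|$ for $r>0$. Let $\Lambda:\mathbb{R}\to\mathbb{R}$ be a function such that $$M_f(r)\le \exp\left(\Lambda(\ln r)\right)\quad\text{for all } r>0 .$$ Then $$|c_n|\le \exp\left(-\Lambda^*(n)\right),\qquad n=1,2,\ldots .$$
   Context: For a real-valued function $g$ on $\mathbb{R}$, its Young-Fenchel (Legendre) transform is $g^*(y)=\sup_{x\in\mathbb{R}}(xy-g(x))\in(-\infty,+\infty]$, $y\in\mathbb{R}$. Convention: $\exp(-\infty)=0$. *)

(* Defs.v *)
From HB Require Import structures.
From mathcomp Require Import all_boot all_order all_algebra.
From mathcomp Require Import complex.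
From mathcomp Require Import all_classical all_reals all_analysis.
Set Implicit Arguments.
Unset Strict Implicit.
Unset Printing Implicit Defensive.
Import Order.TTheory GRing.Theory Num.Theory.
Import numFieldNormedType.Exports.
Local Open Scope classical_set_scope.
Local Open Scope ring_scope.
Local Open Scope complex_scope.

(* The complex plane as a normed space over itself. *)
Notation Cplx R := (R[i]^o).

(* The norm `|z| of R[i] takes its values in R[i]; this is the same modulus
   seen as an element of R. *)
Definition modulus (R : realType) (z : Cplx R) : R := complex.Re `|z|.

Lemma modulusE (R : realType) (z : Cplx R) : (modulus z)%:C = `|z|.
Proof. by rewrite /modulus RRe_real // normr_real. Qed.

(* Differentiability over the field R[i] in the direction 1 is the existence
   of lim_(h -> 0) (f (z + h) - f z) / h for complex h. *)
Definition entire (R : realType) (f : Cplx R -> Cplx R) : Prop :=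
  forall z, derivable f z 1.

Definition power_series_sum (R : realType) (c : nat -> R[i])
    (f : Cplx R -> Cplx R) : Prop :=
  forall z : Cplx R,
    series (fun k => c k * z ^+ k : Cplx R) @ \oo --> f z.

(* The maximum is written as a supremum in the extended reals; by
   max_modulus_attained the two agree whenever the maximum exists, in
   particular for every continuous f and r >= 0. *)
Definition max_modulus (R : realType) (f : Cplx R -> Cplx R) (r : R) : \bar R :=
  ereal_sup [set (modulus (f z))%:E | z in [set z | modulus z <= r]].

Lemma max_modulus_attained (R : realType) (f : Cplx R -> Cplx R) (r : R)
    (z0 : Cplx R) :
  modulus z0 <= r -> (forall z, modulus z <= r -> modulus (f z) <= modulus (f z0)) ->
  max_modulus f r = (modulus (f z0))%:E.
Proof.
move=> z0r z0max; apply/eqP; rewrite eq_le; apply/andP; split.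
- by apply: ge_ereal_sup => _ [z zr <-]; rewrite lee_fin; exact: z0max.
- by apply: ereal_sup_ubound; exists z0.
Qed.

Definition legendre (R : realType) (g : R -> R) (y : R) : \bar R :=
  ereal_sup [set (x * y - g x)%:E | x in [set: R]].

(* Main.v *)
Require Import Defs.
From HB Require Import structures.
From mathcomp Require Import all_boot all_order all_algebra.
From mathcomp Require Import complex.
From mathcomp Require Import cyclic separable cyclotomic.
From mathcomp Require Import all_classical all_reals all_analysis.
From mathcomp Require Import zify ring.
Set Implicit Arguments.
Unset Strict Implicit.
Unset Printing Implicit Defensive.
Import Order.TTheory GRing.Theory Num.Theory.
Import numFieldNormedType.Exports.
Local Open Scope classical_set_scope.
Local Open Scope ring_scope.
Local Open Scope complex_scope.

(** The statement is Cauchy's estimate [|c_n| r^n <= M_f(r)] in logarithmic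
    coordinates: with [r = e^x] it reads [|c_n| <= exp (- (x n - Lambda x))],
    and the infimum of the right-hand side over [x] is [exp (- Lambda^*(n))].

    Cauchy's estimate is obtained without contour integrals. For a polynomial
    [p] of degree less than [N] and a primitive [N]-th root of unity [zeta],
    the average of [zeta^(-jn) p(a zeta^j)] over [j < N] is exactly [p_n a^n],
    so [p_n a^n] is bounded by the maximum of [|p|] on the circle of radius [|a|]
    ([poly_cauchy_estimate]). The partial sums of the series converge to [f]
    uniformly on that circle ([power_series_unif_cvg]), hence they are bounded
    there by [M_f(r) + e] from some rank on, and [e] tends to 0
    ([coef_cauchy_estimate]). *)

Lemma prim_root_exists (F : closedFieldType) (N : nat) :
  N%:R != 0 :> F -> exists z : F, N.-primitive_root z.
Proof.
move=> N_neq0; have N_gt0 : (0 < N)%N by case: N N_neq0; rewrite ?eqxx.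
have [rs XN1E] := closed_field_poly_normal ('X^N - 1 : {poly F}).
rewrite (monicP _) ?monicXnsubC // scale1r in XN1E.
have /hasP[z _ z_prim] : has N.-primitive_root rs; last by exists z.
apply: has_prim_root => //.
- by apply/allP => z; rewrite -root_prod_XsubC -XN1E.
- by rewrite -separable_prod_XsubC -XN1E separable_Xn_sub_1.
- by rewrite -ltnS -(size_prod_XsubC rs id) -XN1E size_XnsubC.
Qed.

Lemma sum_prim_root_pow (F : fieldType) (N : nat) (z : F) (k : nat) :
  N.-primitive_root z ->
  \sum_(j < N) (z ^+ j) ^+ k = if (N %| k)%N then N%:R else 0.
Proof.
move=> z_prim; under eq_bigr do rewrite exprAC.
rewrite (prim_order_dvd z_prim); case: eqP => [-> | /eqP zk_neq1].
  by under eq_bigr do rewrite expr1n; rewrite sumr_const card_ord.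
apply: (mulfI (x := z ^+ k - 1)); first by rewrite subr_eq0.
by rewrite -subrX1 exprAC (prim_expr_order z_prim) expr1n subrr mulr0.
Qed.

(** Writing [zeta^(-jn)] as [(zeta^j)^(N - n)] keeps the exponents natural; the
    term of index [k] then survives only if [N] divides [k + (N - n)], which for
    [k, n < N] forces [k = n]. *)
Lemma coef_roots_of_unity_filter (F : fieldType) (p : {poly F}) (a z : F)
    (N n : nat) :
  N.-primitive_root z -> (size p <= N)%N -> (n < N)%N ->
  \sum_(j < N) (z ^+ j) ^+ (N - n) * p.[a * z ^+ j] = (p`_n * a ^+ n) *+ N.
Proof.
move=> z_prim p_size n_lt.
have termE (j : 'I_N) : (z ^+ j) ^+ (N - n) * p.[a * z ^+ j] =
    \sum_(k < N) p`_k * a ^+ k * (z ^+ j) ^+ (k + (N - n)).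
  rewrite (horner_coef_wide _ p_size) mulr_sumr; apply: eq_bigr => k _.
  by rewrite exprMn exprD mulrC -!mulrA.
under eq_bigr do rewrite termE.
rewrite exchange_big /= (bigD1 (Ordinal n_lt)) //= [X in _ + X]big1 => [|k k_neq].
  rewrite addr0 -mulr_sumr sum_prim_root_pow // subnKC 1?ltnW // dvdnn.
  by rewrite mulr_natr.
rewrite -mulr_sumr sum_prim_root_pow // ifN ?mulr0 //.
apply: contra k_neq => /dvdnP[m km].
apply/eqP/val_inj => /=; have k_lt := ltn_ord k.
have : (0 < m * N < 2 * N)%N by rewrite -km; lia.
by rewrite muln_gt0 ltn_mul2r => /andP[/andP[m0 _] /andP[_ m2]]; nia.
Qed.

(** The estimate averages over the [N]-th roots of unity for any [N] exceeding
    both [n] and the degree of [p]. *)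
Lemma poly_cauchy_estimate (C : numClosedFieldType) (p : {poly C}) (a M : C)
    (n : nat) :
  (forall z, `|z| = `|a| -> `|p.[z]| <= M) -> `|p`_n * a ^+ n| <= M.
Proof.
move=> p_le; set N := maxn (size p) n.+1.
have N_gt0 : (0 < N)%N by rewrite /N leq_max orbT.
have [|z z_prim] := @prim_root_exists C N; first by rewrite pnatr_eq0 -lt0n.
have norm_z : `|z| = 1.
  apply/eqP; rewrite -(@pexpr_eq1 _ `|z| N) // -normrX.
  by rewrite (prim_expr_order z_prim) normr1.
rewrite -(ler_pMn2r N_gt0) -normrMn.
rewrite -(coef_roots_of_unity_filter a z_prim) ?leq_max ?leqnn ?ltnSn ?orbT //.
apply: le_trans (ler_norm_sum _ _ _) _.
rewrite -[leRHS]mulr_natr -[N in N%:R]card_ord mulr_natr -sumr_const.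
apply: ler_sum => j _; rewrite normrM !normrX norm_z !expr1n mul1r.
by apply: p_le; rewrite normrM normrX norm_z expr1n mulr1.
Qed.

(** Convergence at the single point [2 a] suffices: the terms there tend to 0,
    so on [|z| = |a|] the [k]-th term is eventually at most a small constant
    times [2^-k], and the tails are small uniformly in [z]. *)
Lemma power_series_unif_cvg (R : realType) (c : nat -> R[i])
    (f : Cplx R -> Cplx R) (a e : R[i]) :
  power_series_sum c f -> 0 < e ->
  \forall K \near \oo, forall z, `|z| = `|a| ->
    `|f z - series (fun k => c k * z ^+ k) K| <= e.
Proof.
move=> f_series e_gt0.
(* [d] bounds the error at an auxiliary late rank [L], and [4 * d] the block of
   terms between [K] and [L]. *)
have [d d_gt0 ->] : exists2 d : R[i], 0 < d & e = d + 4 * d.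
  by exists (e / 5); [rewrite divr_gt0 | field].
have /cvgrPdist_lt/(_ d d_gt0)[K0 _ K0P] := f_series (2 * a).
have coef_le k : (K0 <= k)%N -> `|c k| * `|a| ^+ k <= (2 * d) / 2 ^+ k.
  move=> k_ge; rewrite ler_pdivlMr ?exprn_gt0 // -mulrA -exprMn.
  have -> : `|a| * 2 = `|2 * a| by rewrite normrM normr_nat mulrC.
  rewrite -normrX -normrM.
  set u := fun k : nat => c k * (2 * a) ^+ k.
  have -> : c k * (2 * a) ^+ k = series u k.+1 - series u k.
    by rewrite /series /= big_nat_recr //= addrAC subrr add0r.
  apply: le_trans (ler_distD (f (2 * a) : R[i]) _ _) _.
  rewrite [leRHS]mulr_natl mulr2n lerD // ltW //; last exact: K0P.
  by rewrite distrC; apply: K0P => /=; lia.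
exists K0 => // K /= K_ge z z_norm.
have tail_le L : (K <= L)%N ->
    `|series (fun k => c k * z ^+ k) L - series (fun k => c k * z ^+ k) K|
      <= 4 * d.
  move=> KL; rewrite sub_series_geq //.
  apply: le_trans (ler_norm_sum _ _ _) _.
  (* [v k.+1 - v k = 2 * d / 2 ^+ k]: the geometric bound telescopes. *)
  pose v k : R[i] := - (4 * d / 2 ^+ k).
  apply: (@le_trans _ _ (\sum_(K <= k < L) (v k.+1 - v k))).
    apply: ler_sum_nat => k /andP[k_ge _].
    rewrite normrM normrX z_norm; apply: le_trans (coef_le _ _) _; first lia.
    rewrite le_eqVlt; apply/orP; left; apply/eqP.
    by rewrite /v exprS; field; rewrite expf_neq0.
  rewrite telescope_sumr // /v opprK addrC lerBlDr.
  rewrite -[leLHS]addr0 lerD //; last first.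
    by rewrite mulr_ge0 ?invr_ge0 ?exprn_ge0 ?mulr_ge0 // ltW.
  rewrite ler_pdivrMr ?exprn_gt0 // ler_peMr ?mulr_ge0 ?(ltW d_gt0) //.
  by rewrite exprn_ege1 // ler1n.
have /cvgrPdist_lt/(_ d d_gt0)[L0 _ L0P] := f_series z.
pose L := maxn K L0.
apply: le_trans (ler_distD (series (fun k => c k * z ^+ k) L : R[i]) _ _) _.
rewrite lerD //; last by apply: tail_le; rewrite leq_maxl.
by apply: ltW; apply: L0P; rewrite /= leq_maxr.
Qed.

Lemma coef_cauchy_estimate (R : realType) (c : nat -> R[i])
    (f : Cplx R -> Cplx R) (r M : R) (n : nat) :
  power_series_sum c f -> 0 <= r ->
  (forall z, modulus z = r -> modulus (f z) <= M) ->
  modulus (c n) * r ^+ n <= M.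
Proof.
move=> f_series r_ge0 f_le; apply/ler_addgt0Pr => e e_gt0.
have eC_gt0 : 0 < e%:C by rewrite ltcR.
have [K0 _ K0P] := power_series_unif_cvg r%:C f_series eC_gt0.
pose K := maxn K0 n.+1.
have n_lt : (n < K)%N by rewrite leq_maxr.
have coefE : (\poly_(k < K) c k)`_n = c n by rewrite coef_poly n_lt.
rewrite -lecR rmorphM rmorphXn /= modulusE.
have -> : `|c n| * r%:C ^+ n = `|(\poly_(k < K) c k)`_n * r%:C ^+ n|.
  by rewrite coefE normrM normrX [`|r%:C|]ger0_norm // lecR.
apply: poly_cauchy_estimate => z z_norm.
have z_mod : modulus z = r.
  by apply: complexI; rewrite modulusE z_norm ger0_norm // lecR.
rewrite horner_poly.
have -> : \sum_(k < K) c k * z ^+ k = series (fun k => c k * z ^+ k) K.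
  by rewrite /series /= big_mkord.
rewrite -[X in `|X|](subrKC (f z)).
apply: le_trans (ler_normD _ _) _; rewrite rmorphD lerD //.
  by rewrite -modulusE lecR f_le.
by rewrite distrC; apply: K0P => //=; rewrite leq_maxl.
Qed.

Theorem proposition2p1 (R : realType) (f : Cplx R -> Cplx R) (c : nat -> R[i])
  (Lambda : R -> R)
  (f_entire : entire f)
  (f_series : power_series_sum c f)
  (f_growth : forall r : R, 0 < r ->
     (max_modulus f r <= (expR (Lambda (ln r)))%:E)%E)
  (n : nat) (n_pos : (0 < n)%N) :
  ((modulus (c n))%:E <= expeR (- legendre Lambda n%:R))%E.
Proof.
have cauchy x : modulus (c n) * expR (x * n%:R) <= expR (Lambda x).
  rewrite expRM_natr; apply: (coef_cauchy_estimate _ f_series).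
    exact: expR_ge0.
  move=> z z_mod; rewrite -lee_fin -[x in Lambda x]expRK.
  apply: le_trans (f_growth _ (expR_gt0 x)).
  by apply: ereal_sup_ubound; exists z => //=; rewrite z_mod.
(* A vanishing coefficient has no logarithm; then the bound is trivial, even if
   the transform is infinite. *)
have [c_le0 | c_gt0] := leP (modulus (c n)) 0.
  by apply: le_trans (expeR_ge0 _); rewrite lee_fin.
rewrite -(@lnK _ (modulus (c n))) // -[(expR _)%:E]/(expeR (ln _)%:E).
rewrite lee_expeR leeNr; apply: ge_ereal_sup => _ [x _ <-].
rewrite -EFinN lee_fin lerBlDl lerBrDr addrC.
by rewrite -ler_expR expRD lnK.
Qed.
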